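(* Let $k\ge 2$ be an integer. If a signed graph $G$ admits a nowhere-zero $k$-flow, then $G$ has a signed circuit cover of total length at most $2(k-1)|E(G)|$.
   Context: Graphs are finite; loops and parallel edges are allowed. A circuit is a connected 2-regular subgraph (a loop is a circuit of length 1, two parallel edges form a circuit of length 2). A *signed graph* is a graph in which each edge is labelled with a sign, $+$ or $-$. Orientation: each edge is divided into two half-edges, one at each of its ends (both at the same vertex for a loop). An *orientation* (bidirection) of a signed graph assigns a direction to each half-edge, either towards or from its end-vertex, so that a positive edge has one half-edge directed from and the other half-edge directed to its end-vertex, while a negative edge has both half-edges directed towards, or both directed from, their respective end-vertices. Flows: an *integer flow* on a signed graph $G$ is an assignment of an orientation and an integer value to each edge such that at each vertex the sum of incoming values equals the sum of outgoing values (every half-edge at the vertex contributes the value of its edge, as incoming if it is directed to the vertex and as outgoing otherwise). A *nowhere-zero $k$-flow* is an integer flow with all values in the set $\{\pm1,\pm2,\ldots,\pm(k-1)\}$. Signed circuits: a circuit is *balanced* if it contains an even number of negative edges, otherwise *unbalanced*. A *signed circuit* of a signed graph is a subgraph of one of the following types: (1) a balanced circuit; (2) the union of two disjoint unbalanced circuits with a path that meets the circuits only at its ends; (3) the union of two unbalanced circuits that meet at a single vertex. A *signed circuit cover* of $G$ is a collection $\mathcal{C}$ of signed circuits of $G$ such that each edge of $G$ is contained in at least one member of $\mathcal{C}$. The length of a signed circuit is its number of edges, and the total length of $\mathcal{C}$ is the sum of the lengths of its members. *)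

(* Defs.v *)
From mathcomp Require Import all_boot all_order all_algebra.
Set Implicit Arguments.
Unset Strict Implicit.
Unset Printing Implicit Defensive.
Import Order.TTheory GRing.Theory Num.Theory.

(* The two half-edges of [e] are [(e, false)] and [(e, true)]; [endpt e b] is
   the end-vertex of [(e, b)].  Loops ([endpt e false = endpt e true]) and
   parallel edges are allowed. *)
Record signed_graph := SignedGraph {
  vertex : finType;
  edge : finType;
  endpt : edge -> bool -> vertex;
  negative : edge -> bool
}.

Section Flows.
Variable G : signed_graph.

(* [d e b] is true when the half-edge [(e, b)] is directed towards its
   end-vertex, false when it is directed from it. *)
Definition is_orientation (d : edge G -> bool -> bool) : Prop :=
  forall e, if negative e then d e false = d e true
            else d e false <> d e true.

Definition is_flow (d : edge G -> bool -> bool) (f : edge G -> int) : Prop :=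
  is_orientation d /\
  forall v : vertex G,
    (\sum_(h : edge G * bool | (endpt h.1 h.2 == v) && d h.1 h.2) f h.1 =
     \sum_(h : edge G * bool | (endpt h.1 h.2 == v) && ~~ d h.1 h.2) f h.1)%R.

Definition admits_nowhere_zero_flow (k : nat) : Prop :=
  exists (d : edge G -> bool -> bool) (f : edge G -> int),
    is_flow d f /\ forall e, 0 < `|f e|%N < k.

End Flows.

(* A vertex set and an edge set; [is_subgraph] says that they form a subgraph. *)
Definition subgraph (G : signed_graph) : Type :=
  ({set vertex G} * {set edge G})%type.

Section Circuits.
Variable G : signed_graph.
Implicit Types (S C P : subgraph G) (x y v : vertex G) (e : edge G).

Definition verts S : {set vertex G} := S.1.
Definition edges S : {set edge G} := S.2.

Definition is_subgraph S : Prop :=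
  forall e b, e \in edges S -> endpt e b \in verts S.

Definition sub_union S1 S2 : subgraph G :=
  (verts S1 :|: verts S2, edges S1 :|: edges S2).

(* Half-edges are counted, so a loop contributes 2. *)
Definition degree S v : nat :=
  #|[set h : edge G * bool | (h.1 \in edges S) && (endpt h.1 h.2 == v)]|.

Definition joins e x y : bool :=
  [exists b, (endpt e b == x) && (endpt e (~~ b) == y)].

Definition adjacent S : rel (vertex G) :=
  fun x y => [exists e, (e \in edges S) && joins e x y].

Definition connected S : Prop :=
  verts S != set0 /\
  {in verts S &, forall x y, connect (adjacent S) x y}.

Definition is_circuit C : Prop :=
  [/\ is_subgraph C, connected C & {in verts C, forall v, degree C v = 2}].

Definition balanced C : bool :=
  ~~ odd #|[set e in edges C | negative e]|.

Definition unbalanced_circuit C : Prop := is_circuit C /\ ~~ balanced C.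

(* A walk from [x] is given by its successive steps: the edge that is traversed
   and the vertex that is reached. *)
Fixpoint is_walk x (p : seq (edge G * vertex G)) : bool :=
  if p is (e, y) :: p' then joins e x y && is_walk y p' else true.

Definition is_path P x y : Prop :=
  exists p : seq (edge G * vertex G),
    [/\ is_walk x p, uniq (x :: unzip2 p), last x (unzip2 p) = y,
        verts P = [set:: x :: unzip2 p] & edges P = [set:: unzip1 p]].

(* In [SignedCircuit3] the circuits are required to share no edge, since
   otherwise two copies of one unbalanced loop would meet at a single vertex. *)
Inductive signed_circuit : subgraph G -> Prop :=
| SignedCircuit1 C :
    is_circuit C -> balanced C -> signed_circuit C
| SignedCircuit2 C1 C2 P x y :
    unbalanced_circuit C1 -> unbalanced_circuit C2 ->
    [disjoint verts C1 & verts C2] ->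
    is_path P x y -> x \in verts C1 -> y \in verts C2 ->
    verts P :&: (verts C1 :|: verts C2) = [set x; y] ->
    signed_circuit (sub_union (sub_union C1 C2) P)
| SignedCircuit3 C1 C2 v :
    unbalanced_circuit C1 -> unbalanced_circuit C2 ->
    verts C1 :&: verts C2 = [set v] -> [disjoint edges C1 & edges C2] ->
    signed_circuit (sub_union C1 C2).

Definition signed_circuit_cover (CC : seq (subgraph G)) : Prop :=
  (forall C, C \in CC -> signed_circuit C) /\
  (forall e, exists2 C, C \in CC & e \in edges C).

Definition total_length (CC : seq (subgraph G)) : nat :=
  \sum_(C <- CC) #|edges C|.

End Circuits.

(* Main.v *)
Require Import Defs.
From mathcomp Require Import all_boot all_order all_algebra.
From mathcomp Require Import zify ring.
From Stdlib Require Import Classical.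

Set Implicit Arguments.
Unset Strict Implicit.
Unset Printing Implicit Defensive.
Import Order.TTheory GRing.Theory Num.Theory.

(** Reversing the orientation of the edges of negative value turns the given
flow into a positive one, [g = |f|], so it suffices to find, for every
nonnegative flow [g], a family of signed circuits that covers the support of
[g] and has total length at most [2 * \sum_e g e].

The orientation is read as a digraph on the states [(v, s)], where [s] is the
direction that the next half-edge taken at [v] must have.  Each edge gives two
arcs, one for each sense of traversal; the symmetry [bar] of the states
reverses all arcs.  Walks in this digraph are the coherent walks of the
bidirected graph.  A nonnegative flow decomposes into closed coherent walks as
an ordinary flow does into closed directed walks ([flow_walk], [flow_cover]),
so what remains is to cover a closed coherent walk [W] by signed circuits of
total length at most [2 * size W] ([closed_walk_cover]).

If the edges of [W] can be redistributed into two shorter nonempty closed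
walks, induction applies.  Otherwise [W] is called irreducible, and it has a
planar structure: no state is repeated, so each vertex is visited at most
twice and then in opposite states, and two such pairs of visits never
interleave, because [W] could then be cut and reconnected, with one piece of
each part reversed ([no_crossing]).  Hence [W] either is a balanced circuit or
reads, up to rotation, [c_1 P_1 c_2 P_2 .. c_m P_m] with [m > 1], where the
[c_i] (the leaves) are unbalanced circuits that return to their first vertex
in the opposite state, and no [P_i] repeats a vertex.  Then each triple
[c_i P_i c_(i+1)], with indices modulo [m], is a signed circuit ([barbell]);
these triples contain every leaf twice and every [P_i] once, which gives the
bound [2 * size W] ([leaf_tour_cover], [irreducible_cover]). *)

(** * Coherent walks *)

Section CoherentWalks.
Variables (G : signed_graph) (d : edge G -> bool -> bool).
Local Notation halfedge := (edge G * bool)%type.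
Local Notation state := (vertex G * bool)%type.
Implicit Types (x y z u v : state) (h : halfedge) (p q c P Q R W : seq halfedge).

(** An arc leaves its first end in the state equal to the direction of the
half-edge there; it reaches its second end in the state opposite to the
direction of the half-edge there, since a walk that enters a vertex along an
incoming half-edge must leave along an outgoing one. *)
Definition src h : state := (endpt h.1 h.2, d h.1 h.2).
Definition tgt h : state := (endpt h.1 (~~ h.2), ~~ d h.1 (~~ h.2)).
Definition bar x : state := (x.1, ~~ x.2).
Definition flip h : halfedge := (h.1, ~~ h.2).
Definition flip_walk p := rev (map flip p).
Definition vsrc h := (src h).1.
Definition vtgt h := (tgt h).1.

Fixpoint dwalk x p y : bool :=
  if p is h :: p' then (src h == x) && dwalk (tgt h) p' y else x == y.

Lemma barK : involutive bar.
Proof. by case=> v s; rewrite /bar /= negbK. Qed.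

Lemma bar_neq x : (bar x == x) = false.
Proof. by case: x => v [] /=; apply/eqP => -[]. Qed.

Lemma eq_or_bar x y : x.1 = y.1 -> x = y \/ x = bar y.
Proof. by case: x y => [v [|]] [w [|]] /= ->; auto. Qed.

Lemma src_flip h : src (flip h) = bar (tgt h).
Proof. by case: h => e b; rewrite /src /bar /= negbK. Qed.

Lemma tgt_flip h : tgt (flip h) = bar (src h).
Proof. by case: h => e b; rewrite /tgt /bar /= negbK. Qed.

Lemma dwalk_cat x p q y :
  dwalk x (p ++ q) y <-> exists2 z, dwalk x p z & dwalk z q y.
Proof.
elim: p x => [|h p IH] x /=.
  by split=> [?|[z /eqP -> //]]; exists x.
split=> [/andP[-> /IH[z ? ?]]|[z /andP[-> ?] ?]]; first by exists z.
by apply/IH; exists z.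
Qed.

Lemma dwalk_catI x p z q y : dwalk x p z -> dwalk z q y -> dwalk x (p ++ q) y.
Proof. by move=> pP qP; apply/dwalk_cat; exists z. Qed.

Lemma dwalk_flip x p y : dwalk x p y -> dwalk (bar y) (flip_walk p) (bar x).
Proof.
rewrite /flip_walk; elim: p x => [|h p IH] x /=; first by move/eqP->.
case/andP=> /eqP <- /IH wp; rewrite rev_cons -cats1; apply: dwalk_catI wp _.
by rewrite /= src_flip tgt_flip !eqxx.
Qed.

Lemma edges_flip_walk p : map fst (flip_walk p) = rev (map fst p).
Proof. by rewrite map_rev -map_comp. Qed.

Lemma dwalk_split x p h q y :
  dwalk x (p ++ h :: q) y -> dwalk x p (src h) /\ dwalk (src h) (h :: q) y.
Proof. by case/dwalk_cat=> z wp /= /andP[/eqP->]; rewrite eqxx. Qed.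

Lemma vertex_seq x p y :
  dwalk x p y -> rcons (map vsrc p) y.1 = x.1 :: map vtgt p.
Proof.
elim: p x => [|h p IH] x /=; first by move/eqP->.
by case/andP=> /eqP <- /IH ->.
Qed.

Lemma same_edge h h' : h.1 = h'.1 -> h' = h \/ h' = flip h.
Proof. by case: h h' => e [] [e' []] /= ->; auto. Qed.

Lemma flipK : involutive flip.
Proof. by case=> e b; rewrite /flip /= negbK. Qed.

Lemma uniq_map_inj (T1 T2 : eqType) (f : T1 -> T2) (s : seq T1) :
  uniq (map f s) -> {in s &, injective f}.
Proof.
elim: s => //= z s IH /andP[zs /IH{}IH] a b; rewrite !inE.
case/predU1P=> [->|sa] /predU1P[->|sb] // E; last exact: IH.
  by rewrite E map_f in zs.
by rewrite -E map_f in zs.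
Qed.

(** * Circuits and paths traced by walks *)

Definition support p : subgraph G :=
  ([set:: map vsrc p], [set:: map fst p]).

Lemma card_support p : #|edges (support p)| <= size p.
Proof. by rewrite cardsE (leq_trans (card_size _)) ?size_map. Qed.

(** In the digraph of states an arc never follows its own reversal: the state
reached by an arc is [bar] of the one from which its reversal starts. *)
Lemma flip_notin x y c h :
  dwalk x c y -> uniq (map vsrc c) -> h \in c -> flip h \notin c.
Proof.
move=> wc Uc.
have next a h1 h2 b : c = a ++ h1 :: h2 :: b -> flip h1 \notin c.
  move=> E; apply/negP => fc.
  have th : src h2 = tgt h1.
    by move: wc; rewrite E => /dwalk_split[_] /= /and3P[_ /eqP].
  have h2c : h2 \in c by rewrite E mem_cat !inE eqxx !orbT.
  have /(uniq_map_inj Uc fc h2c) fh : vsrc (flip h1) = vsrc h2.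
    by rewrite /vsrc th src_flip.
  by have := bar_neq (tgt h1); rewrite -src_flip fh th eqxx.
move=> hc; case/splitPr E: _ / hc => [a [|h2 b]]; last by rewrite -E (next _ _ _ _ E).
rewrite mem_cat inE negb_or andbC.
have -> /= : flip h != h by case: (h) => e [] /=; apply/eqP => -[].
apply/negP => fa; case/splitPr: fa E => a1 a2 E.
have : flip (flip h) \notin c.
  case: a2 E => [|h2 a2] E; first by apply: (next a1 _ h [::]); rewrite E -catA.
  by apply: (next a1 _ h2 (a2 ++ [:: h])); rewrite E -catA.
by rewrite flipK E mem_cat inE eqxx orbT.
Qed.

Lemma edges_uniq x y c :
  dwalk x c y -> uniq (map vsrc c) -> uniq (map fst c).
Proof.
move=> wc Uc; rewrite map_inj_in_uniq; first exact: map_uniq Uc.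
move=> h h' hc h'c /same_edge[] // E.
by have := flip_notin wc Uc hc; rewrite -E h'c.
Qed.

Lemma adjacent_sym S : symmetric (@adjacent G S).
Proof.
move=> u v; apply/existsP/existsP => -[e /andP[eS /existsP[b E]]]; exists e;
  by rewrite eS; apply/existsP; exists (~~ b); rewrite negbK andbC.
Qed.

Lemma adjacent_support c h : h \in c -> adjacent (support c) (vsrc h) (vtgt h).
Proof.
move=> hc; apply/existsP; exists h.1; rewrite inE map_f //=.
by apply/existsP; exists h.2; rewrite !eqxx.
Qed.

Lemma dwalk_connected x p y c h : {subset p <= c} -> dwalk x p y ->
  h \in p -> connect (adjacent (support c)) x.1 (vsrc h).
Proof.
elim: p x => //= h' p IH x sub /andP[/eqP <- wp].
rewrite inE => /predU1P[-> //|hp].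
have adj := @adjacent_support c h' (sub _ (mem_head _ _)).
apply: connect_trans (connect1 adj) _.
by apply: IH wp hp => k kp; rewrite sub // inE kp orbT.
Qed.

Lemma vtgt_perm x y c :
  dwalk x c y -> x.1 = y.1 -> perm_eq (map vsrc c) (map vtgt c).
Proof.
by move=> /vertex_seq E xy; rewrite -(perm_cons x.1) -E xy perm_sym perm_rcons.
Qed.

Lemma vtgt_in x p y h :
  dwalk x p y -> x.1 = y.1 -> h \in p -> vtgt h \in map vsrc p.
Proof. by move=> wp xy hp; rewrite (perm_mem (vtgt_perm wp xy)) map_f. Qed.

(** The half-edges at a vertex are one by which the walk leaves it and one by
which the walk enters it; [flip_notin] makes them distinct. *)
Lemma closed_walk_circuit x y c :
    dwalk x c y -> x.1 = y.1 -> uniq (map vsrc c) -> c != [::] ->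
  is_circuit (support c).
Proof.
move=> wc xy Uc c0; split.
- move=> e b; rewrite !inE => /mapP[h hc /= ->].
  have [->|->] : b = h.2 \/ b = ~~ h.2 by case: b h.2 => [] []; auto.
    exact: (map_f vsrc hc).
  exact: (vtgt_in wc xy hc).
- split.
    case: c c0 {wc Uc} => // h c _; apply/set0Pn; exists (vsrc h).
    by rewrite !inE eqxx.
  have conn (w : vertex G) : w \in verts (support c) ->
      connect (adjacent (support c)) x.1 w.
    by rewrite inE => /mapP[h hc ->]; apply: (dwalk_connected _ wc hc).
  move=> w1 w2 /conn c1 /conn; apply: connect_trans.
  by rewrite (sym_connect_sym (adjacent_sym _)).
move=> v; rewrite inE => vc; have /mapP[h1 h1c v1] := vc.
have vp := vtgt_perm wc xy.
have /mapP[h2 h2c v2] : v \in map vtgt c by rewrite -(perm_mem vp).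
have Ut : uniq (map vtgt c) by rewrite -(perm_uniq vp).
have -> : degree (support c) v = #|[set h1; flip h2]|.
  congr #|pred_of_set _|; apply/setP => h; rewrite !inE.
  apply/andP/orP => [[/mapP[h' h'c E] /eqP vh]|[] /eqP ->].
  - have [E'|E'] := same_edge (esym E); [left|right]; apply/eqP; subst h.
      by apply: (uniq_map_inj Uc) => //; rewrite -v1 -vh.
    by congr flip; apply: (uniq_map_inj Ut) => //; rewrite -v2 -vh.
  - by split; [apply: map_f | rewrite v1].
  - by split; [apply: (map_f fst h2c) | rewrite v2].
rewrite cards2; case: eqP => // E.
by have := flip_notin wc Uc h2c; rewrite -E h1c.
Qed.

Hypothesis or_d : is_orientation d.

(** The state along a coherent walk changes exactly at the negative edges, so
the end states of a walk record the parity of its negative edges. *)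
Lemma state_parity x p y :
  dwalk x p y -> y.2 = x.2 (+) odd (count (fun h => negative h.1) p).
Proof.
elim: p x => [|h p IH] x /=; first by move/eqP->; rewrite addbF.
case/andP=> /eqP <- /IH ->; rewrite oddD addbA; congr (_ (+) _).
case: h => e b /=; have := or_d e.
by case: (negative e); case: b; case: (d e true); case: (d e false).
Qed.

Lemma balanced_support x p y : uniq (map fst p) -> dwalk x p y ->
  balanced (support p) = (y.2 == x.2).
Proof.
move=> Up wp; rewrite /balanced (state_parity wp).
have -> : #|[set e in edges (support p) | negative e]|
          = count (fun h => negative h.1) p.
  rewrite -(count_map fst) -size_filter -(card_uniqP (filter_uniq _ Up)).
  by apply: eq_card => e; rewrite !inE mem_filter andbC.
by case: odd x.2 => [] [].
Qed.

Lemma leaf_circuit x c : dwalk x c (bar x) -> uniq (map vsrc c) ->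
  unbalanced_circuit (support c).
Proof.
move=> wc Uc; split; last first.
  by rewrite (balanced_support (edges_uniq wc Uc) wc) /=; case: x.2.
apply: (closed_walk_circuit wc) => //.
by apply: contraTneq wc => -> /=; rewrite eq_sym bar_neq.
Qed.

Lemma support_path x p y : dwalk x p y -> uniq (rcons (map vsrc p) y.1) ->
  is_path ([set:: rcons (map vsrc p) y.1], [set:: map fst p]) x.1 y.1.
Proof.
move=> wp Up; exists (map (fun h => (h.1, vtgt h)) p).
have -> : unzip2 (map (fun h => (h.1, vtgt h)) p) = map vtgt p.
  by rewrite /unzip2 -map_comp.
have -> : unzip1 (map (fun h => (h.1, vtgt h)) p) = map fst p.
  by rewrite /unzip1 -map_comp.
have E := vertex_seq wp; rewrite -E; split=> //; last first.
  by have /= <- := congr1 (last x.1) E; rewrite last_rcons.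
elim: p x wp {Up E} => //= h p IH x /andP[/eqP <- /IH ->]; rewrite andbT.
by apply/existsP; exists h.2; rewrite !eqxx.
Qed.


(** * Irreducible closed walks *)

Lemma closed_not_simple x p y : dwalk x p y -> x.1 = y.1 -> p != [::] ->
  ~~ uniq (rcons (map vsrc p) y.1).
Proof.
case: p => //= h p /andP[/eqP <- _] <- _.
by rewrite mem_rcons inE eqxx.
Qed.

(** Only the multiset of edges of [W] matters, which makes the notion invariant
under rotations of [W] and under reversal of pieces. *)
Definition irreducible W := forall x y W1 W2,
  dwalk x W1 x -> dwalk y W2 y ->
  perm_eq (map fst (W1 ++ W2)) (map fst W) -> W1 = [::] \/ W2 = [::].

Lemma irreducible_perm W W' :
  perm_eq W W' -> irreducible W -> irreducible W'.
Proof.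
move=> WW' irrW x y W1 W2 w1 w2 E; apply: irrW w1 w2 _.
by rewrite (permPl E) perm_sym perm_map.
Qed.

(** Suppose that [c] and [R] share a vertex besides the one where they are
joined.  If it has the same state in both, [W] splits there into two closed
walks.  If the states are opposite, write [c = A B] and [R = C D], cut at that
vertex; then [A] followed by the reversal of [C], and [B] followed by the
reversal of [D], are closed walks. *)
Lemma no_crossing v c R h h' :
    irreducible (c ++ R) -> dwalk v c (bar v) -> dwalk (bar v) R v ->
    h \in c -> h' \in R -> vsrc h = vsrc h' ->
  src h = v /\ src h' = bar v.
Proof.
move=> irr wc wR hc h'R; case/splitPr: hc irr wc => A B irr /dwalk_split[wA wB].
case/splitPr: h'R irr wR => C D irr /dwalk_split[wC wD].
move=> /eq_or_bar[] E.
  have wBC : dwalk (src h) ((h :: B) ++ C) (src h).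
    by apply: dwalk_catI wB _; rewrite E.
  have wAD : dwalk v (A ++ h' :: D) v by apply: dwalk_catI wA _; rewrite E.
  have [] // := irr _ _ _ _ wBC wAD; last by case: A {wA irr wAD}.
  by apply/perm_map/permP => a; rewrite !count_cat /=; clear; lia.
have {}E : src h' = bar (src h) by rewrite E barK.
have wAC : dwalk v (A ++ flip_walk C) v.
  by apply: dwalk_catI wA _; rewrite -(barK (src h)) -E; have := dwalk_flip wC; rewrite barK.
have wBD : dwalk (src h) ((h :: B) ++ flip_walk (h' :: D)) (src h).
  apply: dwalk_catI wB _; have := dwalk_flip wD.
  by rewrite E barK.
have [|nil|] // := irr _ _ _ _ wAC wBD.
  rewrite !map_cat !edges_flip_walk; apply/permP => a.
  by rewrite !(count_cat, count_rev) /=; clear; lia.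
have A0 : A = [::] by case: (A) nil.
by move: wA; rewrite A0 => /eqP ->; rewrite E.
Qed.

(** [no_crossing], applied to the leaf [c1] and, after a rotation, to the leaf
[c2], yields all the disjointness conditions.  The circuits meet at a vertex
precisely when [P] is empty. *)
Lemma barbell v u c1 P c2 Q :
    irreducible (c1 ++ P ++ c2 ++ Q) ->
    dwalk v c1 (bar v) -> dwalk (bar v) P u ->
    dwalk u c2 (bar u) -> dwalk (bar u) Q v ->
    uniq (map vsrc c1) -> uniq (map vsrc c2) ->
    uniq (rcons (map vsrc P) u.1) ->
  exists2 C, signed_circuit C & edges C = [set:: map fst (c1 ++ P ++ c2)].
Proof.
move=> irr w1 wP w2 wQ U1 U2 UP.
have wR1 : dwalk (bar v) (P ++ c2 ++ Q) v.
  exact: dwalk_catI wP (dwalk_catI w2 wQ).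
have wR2 : dwalk (bar u) (Q ++ c1 ++ P) u.
  exact: dwalk_catI wQ (dwalk_catI w1 wP).
have cross1 h h' := no_crossing (h := h) (h' := h') irr w1 wR1.
have irr2 : irreducible (c2 ++ Q ++ c1 ++ P).
  apply: irreducible_perm irr.
  by rewrite (catA c1) perm_catC -!catA.
have cross2 h h' := no_crossing (h := h) (h' := h') irr2 w2 wR2.
have cross12 h h' : h \in c1 -> h' \in c2 -> vsrc h = vsrc h' ->
    [/\ src h = v, src h' = bar v & u = bar v].
  move=> hc h'c E; have [||-> E'] // := cross1 h h' hc.
    by rewrite !mem_cat h'c orbT.
  split=> //; rewrite -E'; have [] // := cross2 h' h h'c.
  by rewrite !mem_cat hc orbT.
have B1 := leaf_circuit w1 U1; have B2 := leaf_circuit w2 U2.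
have mem_leaf w c : dwalk w c (bar w) -> exists2 h, h \in c & src h = w.
  case: c => [|h c] /=; first by rewrite eq_sym bar_neq.
  by case/andP=> /eqP <- _; exists h; rewrite ?mem_head.
have [h1 h1c s1] := mem_leaf _ _ w1; have [h2 h2c s2] := mem_leaf _ _ w2.
case: (eqVneq P [::]) => [P0|Pn0].
  subst P; move/eqP: wP => uv.
  exists (sub_union (support c1) (support c2)); last first.
    by apply/setP => e; rewrite !inE /= map_cat mem_cat.
  apply: (@SignedCircuit3 _ _ _ v.1) => //.
    apply/setP => w; rewrite !inE; apply/andP/eqP => [[]|->].
      case/mapP=> h hc ->; case/mapP=> h' h'c E.
      by have [<-] := cross12 _ _ hc h'c E.
    split; apply/mapP; first by exists h1; rewrite // /vsrc s1.
    by exists h2; rewrite // /vsrc s2 -uv.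
  rewrite -setI_eq0; apply/eqP/setP => e; rewrite !inE; apply/negP => /andP[].
  case/mapP=> h hc ->; case/mapP=> h' h'c /same_edge[] E; subst h'.
    have [sv sbv _] := cross12 _ _ hc h'c (erefl _).
    by have := bar_neq v; rewrite -sbv sv eqxx.
  (* A common edge is traversed in opposite senses, so both of its ends are
     common to the circuits: it is a loop at [v], and by its states a closed
     walk on its own. *)
  have /mapP[k kc vk] := vtgt_in w1 (erefl _) hc.
  have [|_ th _] := cross12 _ _ kc h'c; first by rewrite -vk /vsrc src_flip.
  have /mapP[k' k'c vk'] := vtgt_in w2 (erefl _) h'c.
  have [|sh _ _] := cross12 _ _ hc k'c; first by rewrite -vk' /vtgt tgt_flip.
  have wh : dwalk v [:: h] v.
    by rewrite /= sh eqxx -(inj_eq (can_inj barK)) -src_flip th eqxx.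
  have [A [B E]] : exists A B, c1 = A ++ h :: B.
    by case/splitPr: hc => A B; exists A, B.
  move: w1 irr; rewrite E => /dwalk_split[wA /andP[_ wB]] irr.
  have wD : dwalk v (A ++ B ++ c2 ++ Q) v.
    rewrite sh in wA; apply: dwalk_catI wA (dwalk_catI _ wR1).
    by move: wh wB; rewrite /= => /andP[_ /eqP->].
  have [] // := irr _ _ _ _ wh wD; last first.
    by case: (A) (B) (c2) h2c => [|? ?] [|? ?] [|? ?].
  by apply/perm_map/permP => a; rewrite /= !count_cat /=; clear; lia.
have hdP : exists2 h, h \in P & src h = bar v.
  case: P Pn0 wP {irr UP wR1 wR2 irr2 cross1 cross2 cross12} => //= h P _ /andP[/eqP <- _].
  by exists h; rewrite ?mem_head.
have uv : u != bar v.
  apply: contraTneq UP => ->; case: hdP => h hP sh.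
  by rewrite rcons_uniq -sh -/(vsrc h) map_f.
exists (sub_union (sub_union (support c1) (support c2))
          ([set:: rcons (map vsrc P) u.1], [set:: map fst P])); last first.
  by apply/setP => e; rewrite !inE /= !map_cat !mem_cat -orbA; congr (_ || _); apply: orbC.
apply: (@SignedCircuit2 _ _ _ _ v.1 u.1) => //.
- rewrite -setI_eq0; apply/eqP/setP => w; rewrite !inE; apply/negP => /andP[].
  case/mapP=> h hc ->; case/mapP=> h' h'c E.
  by have [_ _ /eqP] := cross12 _ _ hc h'c E; rewrite (negPf uv).
- exact: (support_path wP UP).
- by rewrite inE; apply/mapP; exists h1; rewrite // /vsrc s1.
- by rewrite inE; apply/mapP; exists h2; rewrite // /vsrc s2.
apply/setP => w; rewrite !inE mem_rcons inE; apply/idP/orP; last first.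
  case=> /eqP ->.
    case: hdP => h hP sh.
    have -> : v.1 = vsrc h by rewrite /vsrc sh.
    rewrite map_f // orbT /=; apply/orP; left; apply/mapP; exists h1 => //.
    by rewrite /vsrc sh s1.
  rewrite eqxx /=; apply/orP; right; apply/mapP; exists h2 => //.
  by rewrite /vsrc s2.
case/andP=> /predU1P[->|/mapP[h hP ->]]; first by right.
case/orP=> /mapP[h' h'c E].
  have [||sv _] := cross1 h' h h'c; rewrite ?mem_cat ?hP //.
  by left; rewrite E /vsrc sv.
have [||_ sh] := cross2 h' h h'c; rewrite ?mem_cat ?hP ?orbT //.
by move: UP; rewrite rcons_uniq -[u.1]/((bar u).1) -sh -/(vsrc h) map_f.
Qed.

(** A shortest prefix of [R] that visits some vertex twice ends with the part
[c] between the two visits. *)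
Lemma leaf_split x R y :
    dwalk x R y -> ~~ uniq (rcons (map vsrc R) y.1) ->
  exists P c R' u u',
    [/\ R = P ++ c ++ R', dwalk x P u, dwalk u c u', dwalk u' R' y & u'.1 = u.1]
    /\ [/\ uniq (rcons (map vsrc P) u.1), uniq (map vsrc c) & c != [::]].
Proof.
elim/last_ind: R y => [|R h IH] y //= wR.
have [y' wR' wh] : exists2 y', dwalk x R y' & dwalk y' [:: h] y.
  by apply/dwalk_cat; rewrite cats1.
have /= /andP[/eqP hy' /eqP hy] := wh; subst y' y.
have [U|nU _] := boolP (uniq (rcons (map vsrc R) (vsrc h))); last first.
  have [P [c [R' [u [u' [[E wP wc wR'' uu'] H]]]]]] := IH _ wR' nU.
  exists P, c, (rcons R' h), u, u'; split=> //; split=> //.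
    by rewrite E -!cats1 !catA.
  by rewrite -cats1; apply: dwalk_catI wR'' wh.
rewrite -map_rcons in U; rewrite rcons_uniq U andbT negbK => /mapP[k kR E].
case/splitPr EQ: _ / kR wR U => [P c] wR U.
have [wP wc] := dwalk_split wR.
exists P, (k :: c), [::], (src k), (tgt h); split; split=> //=.
- by rewrite cats0.
- move: U; rewrite map_cat cat_uniq => /and3P[+ + _] /=.
  by rewrite rcons_uniq negb_or => -> /andP[->].
- by move: U; rewrite map_cat cat_uniq => /and3P[].
Qed.

(** * Signed circuits covering a closed walk *)

Definition covers (CC : seq (subgraph G)) (s : seq (edge G)) : Prop :=
  (forall C, C \in CC -> signed_circuit C) /\
  (forall e, e \in s -> exists2 C, C \in CC & e \in edges C).

Lemma covers_cat CC1 CC2 s1 s2 s :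
  covers CC1 s1 -> covers CC2 s2 -> {subset s <= s1 ++ s2} ->
  covers (CC1 ++ CC2) s.
Proof.
move=> [sc1 cov1] [sc2 cov2] sub; split.
  by move=> C; rewrite mem_cat => /orP[/sc1|/sc2].
move=> e /sub; rewrite mem_cat => /orP[/cov1|/cov2] [C CC eC]; exists C => //;
  by rewrite mem_cat CC ?orbT.
Qed.

Lemma total_length_cat (CC1 CC2 : seq (subgraph G)) :
  total_length (CC1 ++ CC2) = total_length CC1 + total_length CC2.
Proof. exact: big_cat. Qed.

Lemma barbell_cover v u c1 P c2 Q :
    irreducible (c1 ++ P ++ c2 ++ Q) ->
    dwalk v c1 (bar v) -> dwalk (bar v) P u ->
    dwalk u c2 (bar u) -> dwalk (bar u) Q v ->
    uniq (map vsrc c1) -> uniq (map vsrc c2) ->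
    uniq (rcons (map vsrc P) u.1) ->
  exists2 CC, covers CC (map fst (c1 ++ P ++ c2)) &
    total_length CC <= size c1 + size P + size c2.
Proof.
move=> irr w1 wP w2 wQ U1 U2 UP.
have [C sC eC] := barbell irr w1 wP w2 wQ U1 U2 UP.
exists [:: C].
  by split=> [C'|e es]; [rewrite inE => /eqP -> | exists C; rewrite ?mem_head // eC inE].
rewrite /total_length big_seq1 eC cardsE (leq_trans (card_size _)) //.
by rewrite size_map !size_cat addnA.
Qed.

(** Here [c1] is the first leaf of a closed walk and [c] the current one.
Cutting the next leaf off the rest [R] of the tour gives one barbell and a
shorter rest; once [R] repeats no vertex, the last barbell closes the tour
through [c1].  Every leaf inside [R] lies in two of these barbells, [c] and
[c1] in one each. *)
Lemma leaf_tour_cover v w c1 Y c R :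
    irreducible (c1 ++ Y ++ c ++ R) ->
    dwalk v c1 (bar v) -> dwalk (bar v) Y w ->
    dwalk w c (bar w) -> dwalk (bar w) R v ->
    uniq (map vsrc c1) -> uniq (map vsrc c) ->
  exists2 CC, covers CC (map fst (c ++ R ++ c1)) &
    total_length CC <= size c + 2 * size R + size c1.
Proof.
move=> irr w1 wY wc wR U1; have [n] := ubnP (size R).
elim: n => // n IH in Y w c R irr wY wc wR *; rewrite ltnS => leRn Uc.
have irr' : irreducible (c ++ R ++ c1 ++ Y).
  by apply: irreducible_perm irr; rewrite (catA c1) perm_catC -!catA.
have [UR|nUR] := boolP (uniq (rcons (map vsrc R) v.1)).
  have [CC cov len] := barbell_cover irr' wc wR w1 wY Uc U1 UR.
  by exists CC => //; move: len; clear; lia.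
have [P [c' [R' [u [u' [[ER wP wc' wR' uu'] [UP Uc' c'0]]]]]]] :=
  leaf_split wR nUR.
case: (eq_or_bar uu') => E; subst u'.
  have wD : dwalk v (c1 ++ Y ++ c ++ P ++ R') v.
    exact: dwalk_catI w1 (dwalk_catI wY (dwalk_catI wc (dwalk_catI wP wR'))).
  have [||] := irr _ _ _ _ wc' wD; first 1 last.
  - by move=> c'E; rewrite c'E in c'0.
  - by case: (c1) w1 => //=; rewrite eq_sym bar_neq.
  by apply/perm_map/permP => a; rewrite ER !count_cat; clear; lia.
subst R.
have irr1 : irreducible (c ++ P ++ c' ++ (R' ++ c1 ++ Y)) by rewrite !catA in irr' *.
have wQ : dwalk (bar u) (R' ++ c1 ++ Y) w.
  exact: dwalk_catI wR' (dwalk_catI w1 wY).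
have [CC1 cov1 len1] := barbell_cover irr1 wc wP wc' wQ Uc Uc' UP.
have [|||CC2 cov2 len2] := IH (Y ++ c ++ P) u c' R' _ _ wc' wR' _ Uc'.
- by move: irr; rewrite -!catA.
- exact: dwalk_catI wY (dwalk_catI wc wP).
- apply: leq_trans leRn.
  by case: (c') c'0 => //= ? ? _; rewrite !size_cat /= ?size_cat addnS ltnS addnA leq_addl.
exists (CC1 ++ CC2).
  apply: covers_cat cov1 cov2 _ => e; rewrite !map_cat !mem_cat.
  by do 5?case: (e \in _).
by rewrite total_length_cat !size_cat in len1 len2 *; move: len1 len2; clear; lia.
Qed.

(** The first leaf is found by splitting [W] itself, which returns to its first
vertex.  If this part ends in the state in which it began, it is closed, hence
all of [W], and a balanced circuit.  Otherwise, after a rotation, [W] begins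
with the leaf. *)
Lemma irreducible_cover x W : irreducible W -> W != [::] -> dwalk x W x ->
  exists2 CC, covers CC (map fst W) & total_length CC <= 2 * size W.
Proof.
move=> irr W0 wW.
have nU : ~~ uniq (rcons (map vsrc W) x.1).
  exact: (closed_not_simple wW).
have [P [c [R [u [u' [[EW wP wc wR uu'] [UP Uc c0]]]]]]] := leaf_split wW nU.
have WW' : perm_eq W (c ++ R ++ P) by rewrite EW perm_catC -catA.
case: (eq_or_bar uu') => E; subst u'.
  have RP0 : R ++ P = [::].
    have [||//] := irr _ _ _ _ wc (dwalk_catI wR wP).
      by rewrite perm_map // perm_sym.
    by move=> c'0; rewrite c'0 in c0.
  exists [:: support c]; last first.
    rewrite /total_length big_seq1 (leq_trans (card_support _)) //.
    by rewrite (perm_size WW') size_cat mul2n -addnn -!addnA leq_addr.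
  split=> [C|e].
    rewrite inE => /eqP ->; apply: SignedCircuit1.
      exact: (closed_walk_circuit wc).
    by rewrite (balanced_support (edges_uniq wc Uc) wc).
  rewrite (perm_mem (perm_map fst WW')) RP0 cats0 => ec.
  by exists (support c); rewrite ?mem_head // inE.
have irr' := irreducible_perm WW' irr.
have wRP : dwalk (bar u) (R ++ P) u := dwalk_catI wR wP.
have nU' : ~~ uniq (rcons (map vsrc (R ++ P)) u.1).
  by apply: (closed_not_simple wRP) => //; apply: contraTneq wRP => -> /=; rewrite bar_neq.
have [P' [c' [R' [v [v' [[ER wP' wc' wR' vv'] [UP' Uc' c'0]]]]]]] :=
  leaf_split wRP nU'.
rewrite ER in irr' WW'.
case: (eq_or_bar vv') => E; subst v'.
  have wD := dwalk_catI wc (dwalk_catI wP' wR').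
  have [||] := irr' _ _ _ _ wc' wD; first 1 last.
  - by move=> c'E; rewrite c'E in c'0.
  - by case: (c) c0.
  by apply/perm_map/permP => a; rewrite !count_cat; clear; lia.
have [CC1 cov1 len1] := barbell_cover irr' wc wP' wc' wR' Uc Uc' UP'.
have [CC2 cov2 len2] := leaf_tour_cover irr' wc wP' wc' wR' Uc Uc'.
exists (CC1 ++ CC2).
  apply: covers_cat cov1 cov2 _ => e.
  rewrite (perm_mem (perm_map fst WW')) !map_cat !mem_cat.
  by do 5?case: (e \in _).
have arith (a p b r t1 t2 : nat) : t1 <= a + p + b -> t2 <= b + 2 * r + a ->
    t1 + t2 <= 2 * (a + (p + (b + r))) by clear; lia.
by rewrite (perm_size WW') total_length_cat !size_cat; apply: arith.
Qed.

(** An irreducible walk is covered directly; any other one shares its edges out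
between two shorter closed walks. *)
Lemma closed_walk_cover x W : dwalk x W x ->
  exists2 CC, covers CC (map fst W) & total_length CC <= 2 * size W.
Proof.
have [n] := ubnP (size W); elim: n => // n IH in x W *; rewrite ltnS => leWn wW.
have [->|W0] := eqVneq W [::].
  by exists [::]; rewrite /total_length ?big_nil //; split.
have [irr|red] := classic (irreducible W); first exact: irreducible_cover wW.
have [y [z [W1 [W2 [w1 w2 E [W10 W20]]]]]] : exists y z W1 W2,
    [/\ dwalk y W1 y, dwalk z W2 z, perm_eq (map fst (W1 ++ W2)) (map fst W)
      & W1 != [::] /\ W2 != [::]].
  apply: NNPP => H; apply: red => y z W1 W2 w1 w2 E.
  case: (eqVneq W1 [::]) => [|n1]; first by left.
  case: (eqVneq W2 [::]) => [|n2]; first by right.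
  by case: H; exists y, z, W1, W2.
have := perm_size E; rewrite !size_map size_cat => sz.
have s1 : 0 < size W1 by case: (W1) W10.
have s2 : 0 < size W2 by case: (W2) W20.
have [|CC1 cov1 len1] := IH _ _ _ w1; first by move: sz s2 leWn; clear; lia.
have [|CC2 cov2 len2] := IH _ _ _ w2; first by move: sz s1 leWn; clear; lia.
exists (CC1 ++ CC2).
  by apply: covers_cat cov1 cov2 _ => e; rewrite -(perm_mem E) map_cat.
by rewrite total_length_cat; move: sz len1 len2; clear; lia.
Qed.

(** * Decomposing a nonnegative flow into closed walks *)

Local Open Scope ring_scope.

Definition half_sign (b : bool) : int := if b then 1 else -1.
Definition incidence (e : edge G) (w : vertex G) : int :=
  \sum_(b : bool) (endpt e b == w)%:R * half_sign (d e b).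
(** The excess of incoming over outgoing values at [w]. *)
Definition boundary (g : edge G -> nat) (w : vertex G) : int :=
  \sum_e (g e)%:Z * incidence e w.
Definition state_mass x w : int := (x.1 == w)%:R * half_sign x.2.

(** With the signed masses of states, an arc contributes the difference of the
masses of its end states, so the boundary of a walk telescopes. *)
Lemma incidence_arc h w :
  incidence h.1 w = state_mass (src h) w - state_mass (tgt h) w.
Proof.
rewrite /incidence big_bool /state_mass /=; case: h => e [] /=;
  case: (d e true); case: (d e false) => /=; ring.
Qed.

Lemma boundaryD g1 g2 w :
  boundary (fun e => g1 e + g2 e)%N w = boundary g1 w + boundary g2 w.
Proof. by rewrite -big_split; apply: eq_bigr => e _; rewrite PoszD mulrDl. Qed.

Lemma boundary_eq g1 g2 w : g1 =1 g2 -> boundary g1 w = boundary g2 w.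
Proof. by move=> E; apply: eq_bigr => e _; rewrite E. Qed.

Lemma boundary_arc h w :
  boundary (fun e => e == h.1) w = state_mass (src h) w - state_mass (tgt h) w.
Proof.
rewrite -incidence_arc /boundary (bigD1 h.1) //= eqxx mul1r big1 ?addr0 //.
by move=> e /negPf ->; rewrite mul0r.
Qed.

Lemma boundary_walk x p y w : dwalk x p y ->
  boundary (fun e => count_mem e (map fst p)) w = state_mass x w - state_mass y w.
Proof.
elim: p x => [|h p IH] x /=.
  by move/eqP->; rewrite subrr /boundary big1 // => e _; rewrite mul0r.
case/andP=> /eqP <- /IH E.
rewrite (boundary_eq (g2 := fun e => (e == h.1) + count_mem e (map fst p))%N).
  by rewrite boundaryD boundary_arc E; ring.
by move=> e; rewrite eq_sym.
Qed.

Lemma boundary_sub g1 g w : (forall e, g1 e <= g e)%N ->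
  boundary (fun e => g e - g1 e)%N w = boundary g w - boundary g1 w.
Proof.
move=> le; rewrite -(@boundary_eq (fun e => (g e - g1 e) + g1 e)%N g).
  by rewrite boundaryD addrK.
by move=> e; rewrite subnK.
Qed.

(** If no half-edge of positive value at [x.1] had direction [x.2], the boundary
at [x.1] would be zero or of the sign opposite to [x.2]; but [x] contributes to
it with the sign of [x.2], and a state [y] other than [x] does not cancel
that. *)
Lemma arc_available g x y : x != y ->
  (forall w, boundary g w = state_mass x w - state_mass y w) ->
  exists2 h, src h = x & (0 < g h.1)%N.
Proof.
move=> xy bd; apply: NNPP => no.
have le0 : half_sign x.2 * boundary g x.1 <= 0.
  rewrite mulr_sumr sumr_le0 // => e _; rewrite mulrCA mulr_sumr mulr_sumr.
  rewrite sumr_le0 // => b _; case: (posnP (g e)) => [->|ge]; first by rewrite mul0r.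
  case: eqP => [E|]; last by rewrite mul0r !mulr0.
  have dx : d e b != x.2.
    by apply/eqP => dx; apply: no; exists (e, b) => //; case: (x) E dx => ? ? /= <- <-.
  by case: (d e b) (x.2) dx => [] [] //= _; rewrite /half_sign; lia.
move: le0; rewrite bd /state_mass eqxx; case: x y xy {bd no} => [v s] [w t] /=.
by case: (eqVneq w v) => [->|_]; case: s t => [] []; rewrite ?eqxx.
Qed.

Lemma sum_count_mem (T : finType) (s : seq T) :
  (\sum_x count_mem x s = size s)%N.
Proof.
elim: s => [|a s IH] /=; first by rewrite big1.
rewrite big_split /= IH (bigD1 a) //= eqxx big1 ?addn0 // => x.
by rewrite eq_sym => /negPf ->.
Qed.

(** Extend a walk greedily from [x], taking off the value used; by
[arc_available] it can only stop at [y]. *)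
Lemma flow_walk g x y :
  (forall w, boundary g w = state_mass x w - state_mass y w) ->
  exists2 p, dwalk x p y & forall e, (count_mem e (map fst p) <= g e)%N.
Proof.
have [n] := ubnP (\sum_e g e)%N.
elim: n => // n IH in g x *; rewrite ltnS => len bd.
case: (eqVneq x y) => [->|xy]; first by exists [::]; rewrite /= ?eqxx.
have [h sh gh] := arc_available xy bd.
have le e : ((e == h.1) <= g e)%N by case: eqP => // ->.
have [||p wp pg] := IH (fun e => g e - (e == h.1))%N (tgt h).
- apply: leq_trans len; rewrite (bigD1 h.1) //= [X in (_ < X)%N](bigD1 h.1) //= eqxx.
  rewrite -addSn leq_add //; first by lia.
  by rewrite leq_sum // => e _; rewrite leq_subr.
- by move=> w; rewrite boundary_sub // bd boundary_arc sh; ring.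
exists (h :: p); first by rewrite /= sh eqxx.
by move=> e; have := pg e; rewrite leq_subRL // [e == _]eq_sym.
Qed.

(** Close up an arc of positive value by [flow_walk], subtract the resulting
closed walk, and recurse. *)
Lemma flow_cover g : (forall w, boundary g w = 0) ->
  exists2 CC, covers CC [seq e <- enum (edge G) | (0 < g e)%N] &
    (total_length CC <= 2 * \sum_e g e)%N.
Proof.
have [n] := ubnP (\sum_e g e)%N.
elim: n => // n IH in g *; rewrite ltnS => len bd.
have [/existsP[e0 ge0]|/existsPn g0] := boolP [exists e, 0 < g e]%N; last first.
  exists [::]; last by rewrite /total_length big_nil.
  by split=> // e; rewrite mem_filter (negPf (g0 e)).
pose h : halfedge := (e0, false).
have le e : ((e == h.1) <= g e)%N by case: eqP => // ->.
have [|p wp pg] := @flow_walk (fun e => g e - (e == h.1))%N (tgt h) (src h).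
  by move=> w; rewrite boundary_sub // bd boundary_arc; ring.
pose W := h :: p.
have wW : dwalk (src h) W (src h) by rewrite /= eqxx.
have Wg e : (count_mem e (map fst W) <= g e)%N.
  by have := pg e; rewrite leq_subRL // [e == _]eq_sym.
have [CC1 cov1 len1] := closed_walk_cover wW.
pose g' e := (g e - count_mem e (map fst W))%N.
have sumW : (\sum_e g e = \sum_e g' e + size W)%N.
  have -> : size W = (\sum_e count_mem e (map fst W))%N.
    by rewrite sum_count_mem size_map.
  by rewrite -big_split; apply: eq_bigr => e _; rewrite /= subnK.
have [||CC2 cov2 len2] := IH g'.
- by apply: leq_trans len; rewrite sumW /= addnS ltnS leq_addr.
- by move=> w; rewrite boundary_sub // bd (boundary_walk _ wW) !subrr.
exists (CC1 ++ CC2); last by rewrite total_length_cat sumW; lia.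
apply: covers_cat cov1 cov2 _ => e; rewrite mem_cat !mem_filter => /andP[ge ->].
have [//|eW] := boolP (e \in map fst W).
by rewrite /g' (count_memPn eW) subn0 andbT.
Qed.
End CoherentWalks.

(** * The signed circuit cover *)

Lemma is_flow_boundary (G : signed_graph) d (f : edge G -> int) w :
  is_flow d f -> boundary (fun e b => d e b (+) (f e < 0)%R) (fun e => `|f e|%N) w = 0%R.
Proof.
case=> _ /(_ w) E.
have -> : boundary (fun e b => d e b (+) (f e < 0)%R) (fun e => `|f e|%N) w
  = (\sum_(h : edge G * bool | endpt h.1 h.2 == w) half_sign (d h.1 h.2) * f h.1)%R.
  rewrite [RHS]big_mkcond /=.
  rewrite -(pair_bigA _ (fun e b =>
    if endpt e b == w then half_sign (d e b) * f e else 0)%R) /=.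
  apply: eq_bigr => e _; rewrite mulr_sumr; apply: eq_bigr => b _.
  case: (endpt e b == w); last by rewrite mul0r mulr0.
  rewrite mul1r abszE; case: (ltrgt0P (f e)) => [||->]; case: (d e b);
    rewrite /half_sign /= ?mulr1 ?mulrN1 ?mul1r ?mulN1r ?opprK ?mulr0 ?mul0r ?oppr0 //.
rewrite (bigID (fun h => d h.1 h.2)) /=.
rewrite (eq_bigr (fun h => f h.1)) => [|h /andP[_ ->]]; last by rewrite mul1r.
rewrite E [X in (_ + X)%R](eq_bigr (fun h => - f h.1)%R).
  by rewrite sumrN subrr.
by move=> h /andP[_ /negPf ->]; rewrite mulN1r.
Qed.

Theorem corollary4p2 (k : nat) (G : signed_graph) :
  2 <= k ->
  admits_nowhere_zero_flow G k ->
  exists CC : seq (subgraph G),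
    signed_circuit_cover CC /\ total_length CC <= 2 * (k - 1) * #|edge G|.
Proof.
move=> _ [d [f [flow f_bd]]]; have [or_d _] := flow.
pose d' e b := d e b (+) (f e < 0)%R; pose g e := `|f e|%N.
have or_d' : is_orientation d'.
  move=> e; have := or_d e; rewrite /d'.
  by case: (negative e) => [-> //|ne /addIb].
have [w|CC [sc cov] len] := @flow_cover G d' or_d' g; first exact: is_flow_boundary.
exists CC; split; first split=> // e.
  by apply: cov; rewrite mem_filter mem_enum andbT; case/andP: (f_bd e).
rewrite -mulnA (leq_trans len) // leq_mul2l /= mulnC -sum_nat_const leq_sum // => e _.
by have := f_bd e; rewrite /g; lia.
Qed.
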